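(* Let $R$ be an elementary divisor domain, let $\mathbb{G}$ be its field of fractions, and let $n \geq 1$. For every $\mathbb{G}$-linear subspace $V \subseteq \mathbb{G}^n$, the set $M = V \cap R^n$ is a free $R$-module. Moreover, $M$ is a pure submodule of $R^n$, i.e., every basis of $M$ is an invertible basis.
   Context: Rings are commutative with unity and $1\neq 0$. A square matrix over $R$ is unimodular if it is invertible over $R$. An integral domain $R$ is an elementary divisor domain if for every matrix $A \in R^{m\times n}$ (all $m,n$) there exist unimodular matrices $U \in R^{m\times m}$, $W \in R^{n\times n}$ and a diagonal (possibly rectangular) matrix $S \in R^{m \times n}$ such that $A = USW$ and the $(i,i)$ element of $S$ divides the $(i+1,i+1)$ element of $S$ for all $i<\min\{m,n\}$. A basis of an $R$-module is a linearly independent set of generators; a module is free if it has a basis. The trivial module $\{0\}$ is regarded as free, with the empty set as basis. Invertible basis: if $M \subseteq R^n$ is a free $R$-module with basis $\mathcal{B}$, then $\mathcal{B}$ is called an invertible basis if there is a matrix $A \in R^{n\times p}$ whose columns are the elements of $\mathcal{B}$ and which is left invertible over $R$, i.e., there exists $L \in R^{p\times n}$ with $LA = I_p$. For a free submodule $M$ of $R^n$ over an elementary divisor domain, ''pure submodule'' is used in the sense that every basis of $M$ is invertible. *)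

(* Defs.v *)
From mathcomp Require Import all_boot all_order all_algebra.
From mathcomp Require Import classical_sets.

Set Implicit Arguments.
Unset Strict Implicit.
Unset Printing Implicit Defensive.

Import GRing.Theory.
Local Open Scope ring_scope.
Local Open Scope classical_set_scope.

Definition divides (R : comNzRingType) (a b : R) : Prop :=
  exists c : R, b = c * a.

(* Pairs i : 'I_m, j : 'I_n with equal values index the diagonal of a
   rectangular m x n matrix. *)
Definition divisibility_chain (R : comNzRingType) (m n : nat)
    (S : 'M[R]_(m, n)) : Prop :=
  forall (i i' : 'I_m) (j j' : 'I_n),
    i = j :> nat -> i' = j' :> nat -> i' = i.+1 :> nat ->
    divides (S i j) (S i' j').

Definition elementary_divisor_domain (R : idomainType) : Prop :=
  forall (m n : nat) (A : 'M[R]_(m, n)),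
    exists (U : 'M[R]_m) (S : 'M[R]_(m, n)) (W : 'M[R]_n),
      [/\ U \in unitmx, W \in unitmx, is_diag_mx S, divisibility_chain S
        & A = U *m S *m W].

(* Sets of vectors are arbitrary, in particular not assumed finite; all linear
   combinations are finite. *)
Definition linearly_independent (R : nzRingType) (W : lmodType R)
    (B : set W) : Prop :=
  forall (s : seq W) (c : W -> R),
    uniq s -> (forall v, v \in s -> B v) ->
    \sum_(v <- s) c v *: v = 0 -> forall v, v \in s -> c v = 0.

Definition linear_span (R : nzRingType) (W : lmodType R) (B : set W) : set W :=
  [set w | exists (s : seq W) (c : W -> R),
     (forall v, v \in s -> B v) /\ w = \sum_(v <- s) c v *: v].

(* The equation M = linear_span B makes M a submodule of W containing B. *)
Definition is_basis (R : nzRingType) (W : lmodType R) (M B : set W) : Prop :=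
  linearly_independent B /\ M = linear_span B.

Definition free_module (R : nzRingType) (W : lmodType R) (M : set W) : Prop :=
  exists B : set W, is_basis M B.

(* L *m A = 1%:M forces the columns of A to be pairwise distinct, so they
   enumerate B without repetition. *)
Definition invertible_basis (R : comNzRingType) (n : nat)
    (M B : set 'cV[R]_n) : Prop :=
  is_basis M B /\
  exists (p : nat) (A : 'M[R]_(n, p)),
    B = [set col j A | j in [set: 'I_p]] /\
    exists L : 'M[R]_(p, n), L *m A = 1%:M.

Definition pure_submodule (R : comNzRingType) (n : nat)
    (M : set 'cV[R]_n) : Prop :=
  forall B : set 'cV[R]_n, is_basis M B -> invertible_basis M B.

(* The intersection of V with R^n, as a subset of R^n, where R^n sits in the
   space of columns over the fraction field entrywise. *)
Definition integral_part (R : idomainType) (n : nat)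
    (V : {vspace 'cV[{fraction R}]_n}) : set 'cV[R]_n :=
  [set v | map_mx (@FracField.tofrac R) v \in V].

(* Main.v *)
Require Import Defs.
From mathcomp Require Import all_boot all_order all_algebra.
From mathcomp Require Import classical_sets.

Set Implicit Arguments.
Unset Strict Implicit.
Unset Printing Implicit Defensive.

Import GRing.Theory.
Local Open Scope ring_scope.
Local Open Scope classical_set_scope.

(* V is the kernel of a square matrix over the fraction field; clearing
   denominators, its integral part is the kernel of some K over R. Writing
   K = U S W with S diagonal, this kernel consists of the v such that W v
   vanishes at every index of a nonzero diagonal entry, so it is the range of
   the remaining columns of W^-1, which have the corresponding rows of W as
   left inverse. *)

(** * Linear combinations and independent sets of vectors *)

Lemma mulmx_sum_col (R : comNzRingType) (m n : nat) (A : 'M[R]_(m, n))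
    (x : 'cV[R]_n) : A *m x = \sum_i x i 0 *: col i A.
Proof.
apply/matrixP => i j; rewrite ord1 mxE summxE.
by apply: eq_bigr => k _; rewrite !mxE mulrC.
Qed.

(** Lets combinations over different lists, possibly with repetitions, be rewritten over one common
    duplicate-free list. *)
Lemma lin_comb_subset (R : nzRingType) (W : lmodType R) (s t : seq W)
    (c : W -> R) :
  uniq t -> {subset s <= t} ->
  exists d : W -> R, \sum_(v <- s) c v *: v = \sum_(v <- t) d v *: v.
Proof.
move=> Ut; elim: s => [|a s IHs] sub_st.
  by exists (fun=> 0); rewrite big_nil big1 // => v _; rewrite scale0r.
have [v sv|d Ed] := IHs; first by apply: sub_st; rewrite inE sv orbT.
(* [a] may occur again in [s], so its coefficient is added to [d a] rather than replacing it. *)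
exists (fun v => (if v == a then c a else 0) + d v).
rewrite big_cons Ed; under [RHS]eq_bigr do rewrite scalerDl.
rewrite big_split /=; congr (_ + _).
rewrite (bigD1_seq a) ?sub_st ?mem_head //= eqxx big1 ?addr0 // => v.
by move/negPf ->; rewrite scale0r.
Qed.

(** A vector of [B] outside [s] would give a relation on [v :: s] with coefficient -1 at [v]. This
    is how a basis is shown to be finite. *)
Lemma linearly_independent_sub (R : nzRingType) (W : lmodType R) (B : set W)
    (s : seq W) :
  linearly_independent B -> uniq s -> (forall v, v \in s -> B v) ->
  (forall v, B v -> exists c : W -> R, v = \sum_(w <- s) c w *: w) ->
  forall v, B v -> v \in s.
Proof.
move=> indB Us sB span_s v Bv; apply/negPn/negP => s'v.
have [c Ev] := span_s v Bv.
have /(_ v (mem_head _ _)) : forall w, w \in v :: s ->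
    (if w == v then -1 else c w) = 0.
  apply: (indB (v :: s)) => [|w|]; first by rewrite /= s'v.
    by rewrite inE => /predU1P[-> //|/sB].
  rewrite big_cons eqxx scaleN1r {1}Ev addrC; apply/eqP; rewrite subr_eq0.
  apply/eqP/eq_big_seq => w sw; case: eqP => // wv.
  by rewrite -wv sw in s'v.
by rewrite eqxx => /eqP; rewrite oppr_eq0 oner_eq0.
Qed.

Lemma linearly_independent_mulmx_inj (R : comNzRingType) (n p : nat)
    (B : set 'cV[R]_n) (A : 'M[R]_(n, p)) (x : 'cV[R]_p) :
  linearly_independent B -> injective (fun j => col j A) ->
  (forall j, B (col j A)) -> A *m x = 0 -> x = 0.
Proof.
move=> indB injA BA Ax0; apply/colP => j; rewrite mxE.
(* Independence takes coefficients indexed by vectors; since the columns are distinct, each sum has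
   a single term on columns of [A]. *)
pose c (v : 'cV[R]_n) := \sum_(i | col i A == v) x i 0.
have cE i : c (col i A) = x i 0.
  by rewrite /c (big_pred1 i) // => k; apply: (inj_eq injA).
rewrite -cE; apply: (indB [seq col i A | i : 'I_p]).
- by rewrite map_inj_uniq ?enum_uniq.
- by move=> v /mapP[i _ ->].
- rewrite big_map big_enum /= -[RHS]Ax0 mulmx_sum_col.
  by apply: eq_bigr => i _; rewrite cE.
- by apply: map_f; rewrite mem_enum.
Qed.

(** * Ranges of left invertible matrices *)

Section Range.

Variables (R : comNzRingType) (n p : nat).
Variables (A : 'M[R]_(n, p)) (L : 'M[R]_(p, n)).
Hypothesis LA1 : L *m A = 1%:M.

Let M := range (fun x : 'cV[R]_p => A *m x).

(** [L] sends the [j]-th column of [A] to the [j]-th unit vector, so applying [L] to a combination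
    of columns reads off its coefficients. *)
Lemma range_cols_basis : is_basis M [set col j A | j in [set: 'I_p]].
Proof.
have Lcol j : L *m col j A = delta_mx j 0 by rewrite colE mulmxA LA1 mul1mx.
split=> [s c Us sB s0 v sv|].
  have [j _ Ev] := sB v sv.
  have /(congr1 (fun u => (L *m u) j 0)) := s0.
  rewrite mulmx0 mulmx_sumr summxE mxE (bigD1_seq v) //=.
  rewrite -scalemxAr -Ev Lcol !mxE !eqxx mulr1 Ev big_seq_cond big1 ?addr0 //.
  move=> w /andP[/sB[k _ <-] kv]; rewrite -scalemxAr Lcol !mxE andbT.
  by case: (j =P k) kv => [<-|]; rewrite ?mulr0 // Ev eqxx.
apply/seteqP; split=> [_ [x _ <-]|_ [s [c [sB ->]]]] /=.
  exists [seq col j A | j : 'I_p], (fun v => ((L *m v)^T *m x) 0 0).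
  split=> [v /mapP[j _ ->]|]; first by exists j.
  rewrite big_map big_enum mulmx_sum_col; apply: eq_bigr => j _.
  by rewrite Lcol trmx_delta -rowE mxE.
rewrite big_seq; apply: (big_ind M).
- by exists 0; rewrite ?mulmx0.
- by move=> _ _ [x _ <-] [y _ <-]; exists (x + y); rewrite ?mulmxDr.
- move=> v /sB[j _ <-]; exists (c (col j A) *: delta_mx j 0) => //.
  by rewrite -scalemxAr colE.
Qed.

(* If the columns of C form a basis B of the range of A, then A = C E for some
   E, and C (E L C) = A L C = C; as the columns of C are independent, E L is a
   left inverse of C. *)
Lemma range_pure : pure_submodule M.
Proof.
move=> B basisB; split=> //; have [indB EM] := basisB.
have /fin_all_exists[s /fin_all_exists[c sc]] (j : 'I_p) :
    exists (s : seq 'cV[R]_n) (c : 'cV[R]_n -> R),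
    (forall v, v \in s -> B v) /\ col j A = \sum_(v <- s) c v *: v.
  have: M (col j A) by exists (delta_mx j 0); rewrite ?colE.
  by rewrite EM.
(* Finitely many elements of [B] suffice to express all columns of [A], hence to span [M]; so [B]
   turns out to be the finite list [t]. *)
pose t := undup (flatten [seq s j | j : 'I_p]).
have Ut : uniq t := undup_uniq _.
have tB v : v \in t -> B v.
  by rewrite mem_undup => /flattenP[_ /mapP[j _ ->]]; apply: (sc j).1.
pose C := \matrix_(i < n, j < size t) (tnth (in_tuple t) j) i 0.
have colC j : col j C = tnth (in_tuple t) j.
  by apply/colP => i; rewrite !mxE.
have CE d : \sum_(v <- t) d v *: v = C *m \col_j d (tnth (in_tuple t) j).
  rewrite mulmx_sum_col big_tnth; apply: eq_bigr => j _.
  by rewrite colC mxE.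
have /fin_all_exists[D ED] (j : 'I_p) : exists x, col j A = C *m x.
  have [|d Ed] := @lin_comb_subset _ _ (s j) t (c j) Ut.
    move=> v sv; rewrite mem_undup; apply/flattenP; exists (s j) => //.
    by apply: map_f; rewrite mem_enum.
  by rewrite (sc j).2 Ed CE; eexists.
pose E := \matrix_(i, j) D j i 0.
have AE : A = C *m E.
  apply/matrixP => i j; have /colP/(_ i) := ED j.
  rewrite [LHS]mxE => ->; rewrite !mxE.
  by apply: eq_bigr => k _; rewrite !mxE.
have MB v : B v -> M v.
  move=> Bv; rewrite EM; exists [:: v], (fun=> 1).
  split=> [w|]; first by rewrite inE => /eqP ->.
  by rewrite big_seq1 scale1r.
have Bt : forall v, B v -> v \in t.
  apply: linearly_independent_sub => // v /MB[x _ <-].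
  exists (fun w => \sum_(j | tnth (in_tuple t) j == w) (E *m x) j 0).
  rewrite CE AE -mulmxA; congr (_ *m _); apply/colP => j.
  rewrite [RHS]mxE (big_pred1 j) // => k.
  by rewrite /= (inj_eq (tuple_uniqP _ _)).
exists (size t), C; split.
  apply/seteqP; split=> [v /Bt tv|_ [j _ <-]].
    have /tnthP[j ->] : v \in in_tuple t by [].
    by exists j; rewrite ?colC.
  by rewrite colC; apply/tB/mem_tnth.
have injC : injective (fun j => col j C).
  by move=> j k; rewrite !colC => /(tuple_uniqP (in_tuple t) Ut).
exists (E *m L); apply/eqP; rewrite -subr_eq0; apply/eqP/row_matrixP => i.
suff E0 j : col j (E *m L *m C - 1%:M) = 0.
  by apply/rowP => j; have /colP/(_ i) := E0 j; rewrite !mxE.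
apply: (linearly_independent_mulmx_inj indB injC) => [k|].
  by rewrite colC; apply/tB/mem_tnth.
rewrite !colE mulmxA mulmxBr mulmx1 !mulmxA -AE.
have -> : A *m L *m C = C; last by rewrite subrr mul0mx.
(* Each column of [C] has the form [A *m x], and [A *m L] fixes such vectors because [L *m A] is the
   identity. *)
apply/matrixP => a b; have [x _ Ex] : M (col b C).
  by apply: MB; rewrite colC; apply/tB/mem_tnth.
have /colP/(_ a) : col b (A *m L *m C) = col b C.
  rewrite [LHS]colE -mulmxA -colE -Ex !mulmxA -(mulmxA A L A) LA1.
  by rewrite mulmx1.
by rewrite !mxE.
Qed.

End Range.

(** * Integral parts as kernels over [R], and kernels as ranges *)

(** [d] is the product of the denominators of all entries; each entry cancels its own factor and
    keeps the others. *)
Lemma common_denominator (R : idomainType) (m n : nat)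
    (A : 'M[{fraction R}]_(m, n)) :
  exists (d : R) (B : 'M[R]_(m, n)),
    d != 0 /\ FracField.tofrac d *: A = map_mx (@FracField.tofrac R) B.
Proof.
have fracE (x : {fraction R}) :
    exists b : R * R, b.2 != 0 /\
      FracField.tofrac b.2 * x = FracField.tofrac b.1.
  elim/quotW: x => x; exists (frac x); split; first exact: denom_ratioP.
  apply/eqP; rewrite !piE.
  rewrite FracField.equivfE /FracField.mulf !numden_Ratio ?oner_neq0 ?mul1r //.
  - by rewrite mulr1 mulrC.
  - exact: denom_ratioP.
  - exact: denom_ratioP.
have /fin_all_exists[f fP] (k : 'I_m * 'I_n) := fracE (A k.1 k.2).
exists (\prod_k (f k).2).
exists (\matrix_(i, j) ((f (i, j)).1 * \prod_(k | k != (i, j)) (f k).2)).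
split; first by apply/prodf_neq0 => k _; case: (fP k).
apply/matrixP => i j; rewrite !mxE (bigD1 (i, j)) //= !rmorphM /=.
by rewrite mulrAC (fP (i, j)).2.
Qed.

Lemma integral_part_kernel (R : idomainType) (n : nat)
    (V : {vspace 'cV[{fraction R}]_n}) :
  exists K : 'M[R]_n, integral_part V = [set v | K *m v = 0].
Proof.
(* The matrix of [\1 - projv V], whose kernel is [V]; the transposes appear because [lin1_mx] acts
   on row vectors. *)
pose P := (lin1_mx (trmx \o (\1 - projv V)%VF \o trmx))^T.
have PE v : P *m v = v - projv V v.
  apply: trmx_inj; rewrite trmx_mul trmxK mul_rV_lin1 /= trmxK.
  by rewrite add_lfunE opp_lfunE id_lfunE.
have [d [K [d0 EK]]] := common_denominator P.
have memVE u : (u \in V) = (P *m u == 0).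
  rewrite PE subr_eq0; apply/idP/eqP => [/projv_id ->|->] //.
  exact: memv_proj.
exists K; apply/seteqP; split=> v; rewrite /integral_part /= memVE.
  move=> /eqP Pv0; have: map_mx (@FracField.tofrac R) (K *m v) = 0.
    by rewrite map_mxM -EK -scalemxAl Pv0 scaler0.
  move=> /colP KV0; apply/colP => i; apply/eqP.
  by have := KV0 i; rewrite !mxE => /eqP; rewrite tofrac_eq0.
move=> Kv0; rewrite -(inj_eq (scalerI (_ : FracField.tofrac d != 0))).
  by rewrite scalemxAl EK -map_mxM Kv0 map_mx0 scaler0.
by rewrite tofrac_eq0.
Qed.

Lemma diag_kernel_range (R : idomainType) (m n : nat) (S : 'M[R]_(m, n))
    (W : 'M[R]_n) : is_diag_mx S -> W \in unitmx ->
  exists (p : nat) (A : 'M[R]_(n, p)) (L : 'M[R]_(p, n)),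
    L *m A = 1%:M /\
    [set v : 'cV[R]_n | S *m W *m v = 0] = range (fun x : 'cV_p => A *m x).
Proof.
move=> /is_diag_mxP diagS unitW.
(* Indices of the zero columns of [S]; these include the columns beyond the diagonal when
   [m < n]. *)
pose J := [set j : 'I_n | [forall i : 'I_m, S i j == 0]]%SET.
pose f (k : 'I_#|J|) : 'I_n := enum_val k.
exists #|J|, (colsub f (invmx W)), (rowsub f W); split.
  apply/matrixP => i j; have /matrixP/(_ (f i) (f j)) := mulmxV unitW.
  rewrite !mxE (inj_eq enum_val_inj) => <-.
  by apply: eq_bigr => k _; rewrite !mxE.
apply/seteqP; split=> [v /= SWv0|_ [x _ <-]] /=.
  exists (rowsub f W *m v) => //; rewrite -[RHS](mulKmx unitW).
  rewrite mul_rowsub_mx; set y := W *m v.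
  have y0 j : j \notin J -> y j 0 = 0.
    rewrite inE negb_forall => /existsP[i Sij].
    (* A nonzero entry of column [j] lies on the diagonal, so row [i] of [S *m y = 0] reduces to
       [S i j * y j 0 = 0]. *)
    have ij : i = j :> nat by apply/eqP/negPn; apply: contra Sij => /diagS ->.
    have /matrixP/(_ i 0) := SWv0.
    rewrite -mulmxA mxE (bigD1 j) //= big1 => [|k kj].
      by rewrite addr0 [RHS]mxE => /eqP; rewrite mulf_eq0 (negPf Sij) => /eqP.
    by rewrite diagS ?mul0r // ij eq_sym.
  apply/colP => i; rewrite !mxE [RHS](bigID (mem J)) /=.
  rewrite [X in _ + X]big1 ?addr0 => [|j /y0 ->]; last by rewrite mulr0.
  by rewrite [RHS]big_enum_val; apply: eq_bigr => k _; rewrite !mxE.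
(* [W] cancels against [invmx W], leaving the columns of [S] indexed by [J], which vanish. *)
rewrite mulmxA mulmx_colsub mulmxK // -[RHS](mul0mx _ x); congr (_ *m _).
apply/matrixP => i k; rewrite !mxE; have := enum_valP k.
by rewrite inE => /forallP/(_ i)/eqP.
Qed.

Theorem proposition3p9 (R : idomainType) (hR : elementary_divisor_domain R)
    (n : nat) (hn : (0 < n)%N) (V : {vspace 'cV[{fraction R}]_n}) :
  free_module (integral_part V) /\ pure_submodule (integral_part V).
Proof.
have [K EK] := integral_part_kernel V.
have [U [S [W [unitU unitW diagS _ EUSW]]]] := hR n n K.
have [p [A [L [LA1 EA]]]] := diag_kernel_range diagS unitW.
have -> : integral_part V = range (fun x : 'cV_p => A *m x).
  (* The invertible left factor [U] does not affect the kernel. *)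
  rewrite -EA EK EUSW; apply/seteqP; split=> v /=.
    move=> /(congr1 (mulmx (invmx U))).
    by rewrite mulmx0 !mulmxA mulVmx ?mul1mx.
  by rewrite -!mulmxA => ->; rewrite mulmx0.
split; last exact: range_pure LA1.
by eexists; apply: range_cols_basis LA1.
Qed.
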